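(* Let $k$ be a commutative ring, let $\mathfrak{g}$ be a Lie subalgebra of a Lie algebra $\Xi$ over $k$, let $\mathfrak{h}$ be a $\mathfrak{g}$-complement of $\Xi$, and let $(\mathfrak{g},\mathfrak{h},\triangleright,\triangleleft)$ be the associated canonical matched pair. Then: (1) The relation $\sim$ (equivalence of deformation maps) is an equivalence relation on the set $\mathcal{DM}(\mathfrak{h},\mathfrak{g}\mid(\triangleright,\triangleleft))$ of all deformation maps of the matched pair $(\mathfrak{g},\mathfrak{h},\triangleright,\triangleleft)$. Denote by $\mathcal{HA}^2(\mathfrak{h},\mathfrak{g}\mid(\triangleright,\triangleleft))$ the quotient set $\mathcal{DM}(\mathfrak{h},\mathfrak{g}\mid(\triangleright,\triangleleft))/\sim$. (2) There exists a bijection between the set of isomorphism classes (as Lie algebras) of all $\mathfrak{g}$-complements of $\Xi$ and $\mathcal{HA}^2(\mathfrak{h},\mathfrak{g}\mid(\triangleright,\triangleleft))$. In particular, the factorization index of $\mathfrak{g}$ in $\Xi$ is $$[\Xi:\mathfrak{g}]^f=|\mathcal{HA}^2(\mathfrak{h},\mathfrak{g}\mid(\triangleright,\triangleleft))|.$$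
   Context: All Lie algebras are over a commutative ring $k$. A $\mathfrak{g}$-complement of $\Xi$ is a Lie subalgebra $\mathfrak{h}$ of $\Xi$ such that $\Xi=\mathfrak{g}+\mathfrak{h}$ and $\mathfrak{g}\cap\mathfrak{h}=\{0\}$. The factorization index $[\Xi:\mathfrak{g}]^f$ is the cardinality of the set of Lie algebra isomorphism classes of $\mathfrak{g}$-complements of $\Xi$. A matched pair of Lie algebras $(\mathfrak{g},\mathfrak{h},\triangleright,\triangleleft)$ consists of Lie algebras $\mathfrak{g},\mathfrak{h}$ and $k$-bilinear maps $\triangleright:\mathfrak{h}\times\mathfrak{g}\to\mathfrak{g}$, $\triangleleft:\mathfrak{h}\times\mathfrak{g}\to\mathfrak{h}$ such that for all $a,b\in\mathfrak{g}$, $x,y\in\mathfrak{h}$: $[x,y]\triangleright a=x\triangleright(y\triangleright a)-y\triangleright(x\triangleright a)$; $x\triangleleft[a,b]=(x\triangleleft a)\triangleleft b-(x\triangleleft b)\triangleleft a$; $x\triangleright[a,b]=[x\triangleright a,b]+[a,x\triangleright b]+(x\triangleleft a)\triangleright b-(x\triangleleft b)\triangleright a$; $[x,y]\triangleleft a=[x,y\triangleleft a]+[x\triangleleft a,y]+x\triangleleft(y\triangleright a)-y\triangleleft(x\triangleright a)$. If $\mathfrak{h}$ is a $\mathfrak{g}$-complement of $\Xi$, the associated canonical matched pair is defined by the unique decomposition $[x,a]=x\triangleright a\oplus x\triangleleft a$ in $\Xi=\mathfrak{g}\oplus\mathfrak{h}$, with $x\triangleright a\in\mathfrak{g}$, $x\triangleleft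 a\in\mathfrak{h}$, for all $a\in\mathfrak{g}$, $x\in\mathfrak{h}$. A deformation map of a matched pair $(\mathfrak{g},\mathfrak{h},\triangleright,\triangleleft)$ is a $k$-linear map $r:\mathfrak{h}\to\mathfrak{g}$ such that for all $x,y\in\mathfrak{h}$ $$r([x,y])-[r(x),r(y)]=r\bigl(y\triangleleft r(x)-x\triangleleft r(y)\bigr)+x\triangleright r(y)-y\triangleright r(x).$$ Two deformation maps $r,R:\mathfrak{h}\to\mathfrak{g}$ are equivalent, $r\sim R$, if there exists a $k$-linear automorphism $\sigma:\mathfrak{h}\to\mathfrak{h}$ such that for all $x,y\in\mathfrak{h}$ $$\sigma([x,y])-[\sigma(x),\sigma(y)]=\sigma(x)\triangleleft R(\sigma(y))-\sigma(x\triangleleft r(y))-\sigma(y)\triangleleft R(\sigma(x))+\sigma(y\triangleleft r(x)).$$ *)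

(* Defs.v *)
From HB Require Import structures.
From mathcomp Require Import all_boot all_order all_algebra.
From mathcomp Require Import boolp classical_sets functions cardinality.

Set Implicit Arguments.
Unset Strict Implicit.
Unset Printing Implicit Defensive.

Import GRing.Theory.
Local Open Scope ring_scope.
Local Open Scope classical_set_scope.

HB.mixin Record Lmodule_isLie (k : comPzRingType) L of GRing.Lmodule k L := {
  lieb : L -> L -> L;
  lieb_linearl : forall y, linear (lieb ^~ y);
  lieb_linearr : forall x, linear (lieb x);
  liebxx : forall x, lieb x x = 0;
  lieb_jacobi : forall x y z,
    lieb x (lieb y z) + lieb y (lieb z x) + lieb z (lieb x y) = 0
}.

#[short(type="lieAlgType")]
HB.structure Definition LieAlgebra (k : comPzRingType) :=
  { L of GRing.Lmodule k L & Lmodule_isLie k L }.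

Notation "[ 'lie' x , y ]" := (lieb x y)
  (at level 0, format "[ 'lie'  x ,  y ]") : ring_scope.

Section LieTheory.
Context {k : comPzRingType} {L : lieAlgType k}.
Implicit Types x y z : L.

Lemma liebDl x y z : [lie x + y, z] = [lie x, z] + [lie y, z].
Proof. by have := lieb_linearl z 1 x y; rewrite /= !scale1r. Qed.

Lemma liebDr x y z : [lie x, y + z] = [lie x, y] + [lie x, z].
Proof. by have := lieb_linearr x 1 y z; rewrite /= !scale1r. Qed.

Lemma liebC x y : [lie x, y] = - [lie y, x].
Proof.
apply/eqP; rewrite -addr_eq0; apply/eqP.
by have := liebxx (x + y); rewrite liebDl !liebDr !liebxx add0r addr0.
Qed.

Lemma lieb0r x : [lie x, 0] = 0.
Proof. by apply: (@addrI _ [lie x, 0]); rewrite -liebDr !addr0. Qed.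

Lemma liebNr x y : [lie x, - y] = - [lie x, y].
Proof. by apply/eqP; rewrite -addr_eq0 -liebDr addNr lieb0r. Qed.

Lemma lieb_derr x y z :
  [lie x, [lie y, z]] = [lie [lie x, y], z] + [lie y, [lie x, z]].
Proof.
rewrite [[lie [lie x, y], z]]liebC [[lie x, z]]liebC liebNr -opprD.
apply/eqP; rewrite -addr_eq0; apply/eqP.
by rewrite [X in _ + X]addrC addrA lieb_jacobi.
Qed.

Lemma lieb_derl x y z :
  [lie [lie x, y], z] = [lie x, [lie y, z]] - [lie y, [lie x, z]].
Proof. by rewrite lieb_derr addrK. Qed.

End LieTheory.

Record lieSubalg (k : comPzRingType) (Xi : lieAlgType k) := LieSubalg {
  lsub_set : set Xi;
  lsub0 : lsub_set 0;
  lsubZD : forall (c : k) x y, lsub_set x -> lsub_set y -> lsub_set (c *: x + y);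
  lsub_lieb : forall x y, lsub_set x -> lsub_set y -> lsub_set [lie x, y]
}.

Section SubLie.
Context {k : comPzRingType} {Xi : lieAlgType k}.

Definition lsub_pred (h : lieSubalg Xi) : {pred Xi} :=
  fun x => `[< lsub_set h x >].

Lemma lsub_pred_submod (h : lieSubalg Xi) : subsemimod_closed (lsub_pred h).
Proof.
have D x y : lsub_set h x -> lsub_set h y -> lsub_set h (x + y).
  by move=> hx hy; rewrite -[x]scale1r; apply: lsubZD.
split; first split.
- exact/asboolP/lsub0.
- by move=> x y /asboolP hx /asboolP hy; apply/asboolP/D.
- move=> c x /asboolP hx; apply/asboolP; rewrite -[_ *: _]addr0.
  exact: lsubZD hx (lsub0 h).
Qed.

HB.instance Definition _ (h : lieSubalg Xi) :=
  GRing.isSubmodClosed.Build k Xi (lsub_pred h) (lsub_pred_submod h).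

Definition lsub_type (h : lieSubalg Xi) : Type := {x : Xi | lsub_pred h x}.

Section Instances.
Variable h : lieSubalg Xi.

HB.instance Definition _ := SubChoice.on (lsub_type h).
HB.instance Definition _ := [SubChoice_isSubLmodule of lsub_type h by <:].

Lemma lsub_valP (x : lsub_type h) : lsub_set h (val x).
Proof. exact/asboolP/(valP x). Qed.

Lemma lsub_lieb_pred (x y : lsub_type h) : lsub_pred h [lie val x, val y].
Proof. by apply/asboolP/lsub_lieb; apply: lsub_valP. Qed.

Definition lsub_bracket (x y : lsub_type h) : lsub_type h :=
  exist _ [lie val x, val y] (lsub_lieb_pred x y).

Lemma lsub_linearl y : linear (lsub_bracket ^~ y).
Proof. by move=> c x z; apply: val_inj; rewrite linearP /= lieb_linearl. Qed.

Lemma lsub_linearr x : linear (lsub_bracket x).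
Proof. by move=> c y z; apply: val_inj; rewrite linearP /= lieb_linearr. Qed.

Lemma lsub_xx x : lsub_bracket x x = 0.
Proof. by apply: val_inj; rewrite /= liebxx. Qed.

Lemma lsub_jacobi x y z :
  lsub_bracket x (lsub_bracket y z) + lsub_bracket y (lsub_bracket z x) +
    lsub_bracket z (lsub_bracket x y) = 0.
Proof. by apply: val_inj; rewrite /= lieb_jacobi. Qed.

HB.instance Definition _ := Lmodule_isLie.Build k (lsub_type h)
  lsub_linearl lsub_linearr lsub_xx lsub_jacobi.

End Instances.

End SubLie.

Coercion lsub_type : lieSubalg >-> Sortclass.

Definition lie_isomorphic (k : comPzRingType) (L1 L2 : lieAlgType k) : Prop :=
  exists f : {linear L1 -> L2},
    bijective f /\ forall x y, f [lie x, y] = [lie f x, f y].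

Definition bilinear_map (k : comPzRingType) (U V W : lmodType k)
    (f : U -> V -> W) : Prop :=
  (forall v, linear (f ^~ v)) /\ (forall u, linear (f u)).

Record matchedPair (k : comPzRingType) (g h : lieAlgType k) := MatchedPair {
  lact : h -> g -> g;
  ract : h -> g -> h;
  lact_bilinear : bilinear_map lact;
  ract_bilinear : bilinear_map ract;
  lact_lieb : forall x y a,
    lact [lie x, y] a = lact x (lact y a) - lact y (lact x a);
  ract_lieb : forall x a b,
    ract x [lie a, b] = ract (ract x a) b - ract (ract x b) a;
  lact_liebr : forall x a b,
    lact x [lie a, b] = [lie lact x a, b] + [lie a, lact x b]
                        + lact (ract x a) b - lact (ract x b) a;
  ract_liebl : forall x y a,
    ract [lie x, y] a = [lie x, ract y a] + [lie ract x a, y]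
                        + ract x (lact y a) - ract y (lact x a)
}.

Definition is_complement (k : comPzRingType) (Xi : lieAlgType k)
    (g h : lieSubalg Xi) : Prop :=
  [set a + x | a in lsub_set g & x in lsub_set h] = setT /\
  lsub_set g `&` lsub_set h = [set 0].

Section CanonicalMatchedPair.
Context {k : comPzRingType} {Xi : lieAlgType k} {g h : lieSubalg Xi}.
Hypothesis hc : is_complement g h.

Lemma complement_decomp (z : Xi) : exists p : g * h, z = val p.1 + val p.2.
Proof.
have : [set a + x | a in lsub_set g & x in lsub_set h] z by rewrite hc.1.
case=> a /asboolP ga [x /asboolP hx <-].
by exists (exist _ a ga, exist _ x hx).
Qed.

Lemma complement_decomp_uniq (a b : g) (x y : h) :
  val a + val x = val b + val y -> a = b /\ x = y.
Proof.
move=> e; have {e} e : val (a - b) = val (y - x).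
  by rewrite !raddfB /=; apply/eqP; rewrite subr_eq addrAC eq_sym subr_eq e addrC.
have : (lsub_set g `&` lsub_set h) (val (a - b)).
  by split; last rewrite e; apply: lsub_valP.
rewrite hc.2 /= => e0; split; apply/eqP.
  by rewrite -subr_eq0; apply/eqP/val_inj.
by rewrite eq_sym -subr_eq0; apply/eqP/val_inj; rewrite -e.
Qed.

Definition complement_proj (z : Xi) : g * h := projT1 (cid (complement_decomp z)).

Lemma complement_projE z :
  z = val (complement_proj z).1 + val (complement_proj z).2.
Proof. exact: projT2 (cid (complement_decomp z)). Qed.

Definition canonical_lact (x : h) (a : g) : g :=
  (complement_proj [lie val x, val a]).1.

Definition canonical_ract (x : h) (a : g) : h :=
  (complement_proj [lie val x, val a]).2.

Lemma canonical_actE (x : h) (a : g) :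
  [lie val x, val a] = val (canonical_lact x a) + val (canonical_ract x a).
Proof. exact: complement_projE. Qed.

Let lact := canonical_lact.
Let ract := canonical_ract.

Lemma canonical_linearl (a : g) (c : k) (x y : h) :
  lact (c *: x + y) a = c *: lact x a + lact y a /\
  ract (c *: x + y) a = c *: ract x a + ract y a.
Proof.
apply: complement_decomp_uniq; rewrite -canonical_actE !linearP /=.
by rewrite lieb_linearl !canonical_actE scalerDr addrACA.
Qed.

Lemma canonical_linearr (x : h) (c : k) (a b : g) :
  lact x (c *: a + b) = c *: lact x a + lact x b /\
  ract x (c *: a + b) = c *: ract x a + ract x b.
Proof.
apply: complement_decomp_uniq; rewrite -canonical_actE !linearP /=.
by rewrite lieb_linearr !canonical_actE scalerDr addrACA.
Qed.

Lemma canonical_lact_bilinear : bilinear_map lact.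
Proof.
by split=> [a c x y|x c a b]; [case: (canonical_linearl a c x y)
                              |case: (canonical_linearr x c a b)].
Qed.

Lemma canonical_ract_bilinear : bilinear_map ract.
Proof.
by split=> [a c x y|x c a b]; [case: (canonical_linearl a c x y)
                              |case: (canonical_linearr x c a b)].
Qed.

Lemma canonical_lieb_l (x y : h) (a : g) :
  lact [lie x, y] a = lact x (lact y a) - lact y (lact x a) /\
  ract [lie x, y] a = [lie x, ract y a] + [lie ract x a, y]
                      + ract x (lact y a) - ract y (lact x a).
Proof.
apply: complement_decomp_uniq; rewrite -canonical_actE.
rewrite !(raddfB, raddfD) /= lieb_derl !canonical_actE !liebDr !canonical_actE.
rewrite [[lie sval (ract x a), _]]liebC !opprD.
set p := sval (lact x (lact y a)); set q := sval (ract x (lact y a)).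
set s := sval (lact y (lact x a)); set t := sval (ract y (lact x a)).
set u := lieb _ _; set v := lieb _ _.
rewrite -!addrA; congr (_ + _).
by rewrite (AC (1*(1*(1*(1*1)))) (3*(2*(5*(1*4)))))%AC.
Qed.

Lemma canonical_lieb_r (x : h) (a b : g) :
  lact x [lie a, b] = [lie lact x a, b] + [lie a, lact x b]
                      + lact (ract x a) b - lact (ract x b) a /\
  ract x [lie a, b] = ract (ract x a) b - ract (ract x b) a.
Proof.
apply: complement_decomp_uniq; rewrite -canonical_actE.
rewrite !(raddfB, raddfD) /= lieb_derr !canonical_actE liebDl liebDr.
rewrite [[lie sval a, sval (ract x b)]]liebC !canonical_actE opprD.
by rewrite -!addrA (AC (1*(1*(1*(1*(1*1))))) (1*(4*(2*(5*(3*6))))))%AC.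
Qed.

Definition canonical_matched_pair : matchedPair g h :=
  MatchedPair canonical_lact_bilinear canonical_ract_bilinear
    (fun x y a => (canonical_lieb_l x y a).1)
    (fun x a b => (canonical_lieb_r x a b).2)
    (fun x a b => (canonical_lieb_r x a b).1)
    (fun x y a => (canonical_lieb_l x y a).2).

End CanonicalMatchedPair.

Section DeformationMaps.
Context {k : comPzRingType} {g h : lieAlgType k}.
Variable M : matchedPair g h.

Local Notation "x |> a" := (lact M x a) (at level 40).
Local Notation "x <| a" := (ract M x a) (at level 40).

Definition deformation_maps : set {linear h -> g} :=
  [set r | forall x y : h,
    r [lie x, y] - [lie r x, r y] =
      r (y <| r x - x <| r y) + x |> r y - y |> r x].

Definition deformation_equiv (r R : {linear h -> g}) : Prop :=
  exists sigma : {linear h -> h}, bijective sigma /\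
    forall x y : h,
      sigma [lie x, y] - [lie sigma x, sigma y] =
        sigma x <| R (sigma y) - sigma (x <| r y)
        - sigma y <| R (sigma x) + sigma (y <| r x).

End DeformationMaps.

Definition equivalence_on (T : Type) (A : set T) (E : T -> T -> Prop) : Prop :=
  [/\ forall x, A x -> E x x,
      forall x y, A x -> A y -> E x y -> E y x &
      forall x y z, A x -> A y -> A z -> E x y -> E y z -> E x z].

Definition quotient_set (T : Type) (A : set T) (E : T -> T -> Prop) :
    set (set T) :=
  [set [set y | A y /\ E x y] | x in A].

Definition HA2 (k : comPzRingType) (g h : lieAlgType k) (M : matchedPair g h) :=
  quotient_set (deformation_maps M) (deformation_equiv M).

(* Cardinals are not objects here: the factorization index is the cardinality
   of this set, and equalities of cardinals are expressed with [#=]. *)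
Definition complement_classes (k : comPzRingType) (Xi : lieAlgType k)
    (g : lieSubalg Xi) : set (set (lieSubalg Xi)) :=
  quotient_set [set h | is_complement g h] (fun h1 h2 => lie_isomorphic h1 h2).

(* Main.v *)
Require Import Defs.
From HB Require Import structures.
From mathcomp Require Import all_boot all_order all_algebra.
From mathcomp Require Import boolp classical_sets functions cardinality.

(** Since [Xi] is the direct sum of [g] and [h] as a module, the submodules
    complementary to [g] are exactly the graphs [{r x + x | x in h}] of the
    linear maps [r : h -> g]. Expanding the bracket of two elements of such a
    graph gives

      [[r x + x, r y + y] =
         ([r x, r y] + x |> r y - y |> r x) + ([x, y] + x <| r y - y <| r x)],

    with the first group in [g] and the second in [h]. Hence the graph is a Lie
    subalgebra iff [r] sends the second group to the first, which after moving
    terms is the equation of a deformation map ([graph_lieb_closed]). The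
    second group is a new bracket on the module [h] ([deformed_bracket]), and
    [x |-> r x + x] carries it to the bracket of the graph ([graph_iso]).

    The relation [r ~ R] says, again up to moving terms, that the brackets
    deformed by [r] and by [R] are isomorphic ([deformation_equivE]). It is
    therefore an equivalence relation, and it holds iff the graphs of [r] and
    [R] are isomorphic Lie algebras ([graph_iso_equiv]). So the correspondence
    between complements and deformation maps descends to a bijection between
    the quotients ([quotient_correspondence]). *)

Set Implicit Arguments.
Unset Strict Implicit.
Unset Printing Implicit Defensive.
Import GRing.Theory.

(** * Modules with an arbitrary binary operation, up to linear isomorphism *)

Section BracketIso.
Local Open Scope ring_scope.
Context {k : comPzRingType}.

Lemma linear_pack (U V : lmodType k) (f : U -> V) :
  linear f -> exists F : {linear U -> V}, F =1 f.
Proof.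
move=> lf; pose c := GRing.isLinear.Build k U V *:%R f lf.
by exists (HB.pack_for {linear U -> V} f c).
Qed.

(** No axioms are imposed on [b] and [c], so that deformed brackets on [h] can be
    compared without giving [h] a second Lie algebra structure. For the brackets
    of two Lie algebras this unfolds to [lie_isomorphic]. *)
Definition bracket_iso (U V : lmodType k) (b : U -> U -> U) (c : V -> V -> V) :=
  exists f : {linear U -> V},
    bijective f /\ forall x y, f (b x y) = c (f x) (f y).

Lemma bracket_iso_refl (U : lmodType k) (b : U -> U -> U) : bracket_iso b b.
Proof. by exists idfun; split=> //; exists idfun. Qed.

Lemma bracket_iso_trans (U V W : lmodType k) (b : U -> U -> U)
    (c : V -> V -> V) (d : W -> W -> W) :
  bracket_iso b c -> bracket_iso c d -> bracket_iso b d.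
Proof.
move=> [f [bf fE]] [g [bg gE]]; exists (g \o f); split; first exact: bij_comp.
by move=> x y; rewrite /= fE gE.
Qed.

Lemma bracket_iso_sym (U V : lmodType k) (b : U -> U -> U) (c : V -> V -> V) :
  bracket_iso b c -> bracket_iso c b.
Proof.
move=> [f [[g fK gK] fE]].
have [G GE] : exists G : {linear V -> U}, G =1 g.
  apply: linear_pack => a x y.
  by apply: (can_inj fK); rewrite linearP !gK.
exists G; split; first by exists f => x; rewrite GE.
by move=> x y; rewrite !GE; apply: (can_inj fK); rewrite fE !gK.
Qed.

End BracketIso.

(** * Bijections between quotient sets *)

Section QuotientCorrespondence.
Local Open Scope classical_set_scope.
Variables (T U : Type) (A : set T) (B : set U).
Variables (E : T -> T -> Prop) (E' : U -> U -> Prop) (G : T -> U -> Prop).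
Hypothesis G_total : forall x, A x -> exists2 y, B y & G x y.
Hypothesis G_surj : forall y, B y -> exists2 x, A x & G x y.
Hypothesis G_compat : forall x x' y y', G x y -> G x' y' -> E x x' <-> E' y y'.

(** A relation [G] suffices in place of a map: the class of [x] is sent to the
    set of all elements related by [G] to some member of the class, which by
    compatibility is a full class of [E']. *)
Lemma quotient_correspondence :
  exists F, set_bij (quotient_set A E) (quotient_set B E') F.
Proof.
pose F (c : set T) := [set y | B y /\ exists2 x, c x & G x y].
have FE x y : G x y ->
    F [set x' | A x' /\ E x x'] = [set y' | B y' /\ E' y y'].
  move=> xy; apply/seteqP; split=> y' /= [By'].
    by move=> [x' [_ xx'] x'y']; split=> //; apply/(G_compat xy x'y').
  move=> yy'; split=> //; have [x' Ax' x'y'] := G_surj By'.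
  by exists x' => //; split=> //; apply/(G_compat xy x'y').
exists F; split.
- move=> _ [x /G_total[y By xy] <-]; rewrite /= (FE _ _ xy); by exists y.
- move=> _ _ /set_mem[x Ax <-] /set_mem[x' Ax' <-].
  have [y _ xy] := G_total Ax; have [y' _ xy'] := G_total Ax'.
  rewrite (FE _ _ xy) (FE _ _ xy') => /seteqP[s s'].
  apply/seteqP; split=> z /= [Az xz]; split=> //; have [w Bw zw] := G_total Az.
    apply/(G_compat xy' zw); apply: (s _ _).2.
    by split=> //; apply/(G_compat xy zw).
  apply/(G_compat xy zw); apply: (s' _ _).2.
  by split=> //; apply/(G_compat xy' zw).
- move=> _ [y By <-]; have [x Ax xy] := G_surj By.
  by exists [set x' | A x' /\ E x x']; [exists x|exact: FE].
Qed.

End QuotientCorrespondence.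

(** * Deformed brackets *)

Section Deformation.
Local Open Scope ring_scope.
Context {k : comPzRingType}.

(** Two equations in an abelian group that differ only by moving terms across
    the equality sign have the same difference of sides. *)
Lemma eq_of_subr_eq (V : zmodType) (a b c d : V) :
  a - b = c - d -> a = b <-> c = d.
Proof.
by move=> e; split=> /eqP; rewrite -subr_eq0 => /eqP f; apply/eqP;
  rewrite -subr_eq0 ?e ?f // -e f.
Qed.

Definition deformed_bracket {g h : lieAlgType k} (M : matchedPair g h)
  (r : h -> g) (x y : h) : h := [lie x, y] + ract M x (r y) - ract M y (r x).

Lemma deformation_equivE (g h : lieAlgType k) (M : matchedPair g h)
    (r R : {linear h -> g}) :
  deformation_equiv M r R <->
  bracket_iso (deformed_bracket M r) (deformed_bracket M R).
Proof.
suff E (s : {linear h -> h}) x y :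
    (s [lie x, y] - [lie s x, s y] =
        ract M (s x) (R (s y)) - s (ract M x (r y))
        - ract M (s y) (R (s x)) + s (ract M y (r x))) <->
    s (deformed_bracket M r x y) = deformed_bracket M R (s x) (s y).
  by split=> -[s [bs sE]]; exists s; split=> // x y; apply/E/sE.
apply: eq_of_subr_eq; rewrite /deformed_bracket !(raddfB, raddfD) /=.
rewrite ?(opprD, opprK) -!addrA; congr (_ + _).
by rewrite (AC (1*(1*(1*(1*1)))) (3*(5*(1*(2*4)))))%AC.
Qed.

Lemma deformation_equiv_equivalence (g h : lieAlgType k) (M : matchedPair g h) :
  equivalence_on (deformation_maps M) (deformation_equiv M).
Proof.
split.
- by move=> r _; apply/deformation_equivE/bracket_iso_refl.
- move=> r R _ _ /deformation_equivE e.
  exact/deformation_equivE/bracket_iso_sym.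
- move=> r R S _ _ _ /deformation_equivE e /deformation_equivE e'.
  exact/deformation_equivE/(bracket_iso_trans e).
Qed.

(** In this form the equation says that the [g]-component of
    [[r x + x, r y + y]] is the image under [r] of its [h]-component. *)
Lemma deformation_mapsE (g h : lieAlgType k) (M : matchedPair g h)
    (r : {linear h -> g}) :
  deformation_maps M r <->
  forall x y, r (deformed_bracket M r x y) =
    [lie r x, r y] + lact M x (r y) - lact M y (r x).
Proof.
suff E x y : (r [lie x, y] - [lie r x, r y] =
      r (ract M y (r x) - ract M x (r y)) + lact M x (r y) - lact M y (r x)) <->
    r (deformed_bracket M r x y) =
      [lie r x, r y] + lact M x (r y) - lact M y (r x).
  by split=> rE x y; apply/E/rE.
apply: eq_of_subr_eq; rewrite /deformed_bracket !(raddfB, raddfD) /=.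
rewrite ?(opprD, opprK) -!addrA; congr (_ + _).
by rewrite (AC (1*(1*(1*(1*1)))) (3*(2*(1*(4*5)))))%AC.
Qed.

End Deformation.

(** * Complements as graphs of deformation maps *)

Section Graph.
Local Open Scope ring_scope.
Local Open Scope classical_set_scope.
Context {k : comPzRingType} {Xi : lieAlgType k} {g h : lieSubalg Xi}.
Hypothesis hc : is_complement g h.
Let M := canonical_matched_pair hc.

Definition graph (r : h -> g) : set Xi := range (fun x => val (r x) + val x).

Lemma lieb_graph (r : h -> g) (x y : h) :
  [lie val (r x) + val x, val (r y) + val y] =
  val ([lie r x, r y] + lact M x (r y) - lact M y (r x)) +
  val (deformed_bracket M r x y).
Proof.
rewrite /deformed_bracket !(raddfB, raddfD) /= !liebDl !liebDr.
rewrite [[lie val (r x), val y]]liebC !(canonical_actE hc) opprD /=.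
rewrite -!addrA; congr (_ + _).
by rewrite (AC (1*(1*(1*(1*1)))) (3*(1*(5*(4*2)))))%AC.
Qed.

(** A sum [a + x] with [a] in [g] and [x] in [h] lies in the graph of [r] iff
    [a = r x], so closure under brackets is read off from [lieb_graph]. *)
Lemma graph_lieb_closed (r : {linear h -> g}) :
  (forall u v, graph r u -> graph r v -> graph r [lie u, v]) <->
  deformation_maps M r.
Proof.
split=> [cl|/deformation_mapsE rE u v [x _ <-] [y _ <-]]; last first.
  by rewrite lieb_graph -rE; exists (deformed_bracket M r x y).
apply/deformation_mapsE => x y.
have [||z _] := cl (val (r x) + val x) (val (r y) + val y).
- by exists x.
- by exists y.
by rewrite lieb_graph => /(complement_decomp_uniq hc)[<- <-].
Qed.

Lemma graph_complement (h' : lieSubalg Xi) (r : {linear h -> g}) :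
  lsub_set h' = graph r -> is_complement g h'.
Proof.
move=> e; rewrite /is_complement e; split; apply/seteqP; split=> // z.
  move=> _; have [[a x] /= ->] := complement_decomp hc z.
  (* [a + x = (a - r x) + (r x + x)] *)
  exists (val (a - r x)); first exact: lsub_valP.
  exists (val (r x) + val x); first by exists x.
  by rewrite raddfB /= addrA subrK.
- move=> [/asboolP gz [x _ xE]].
  (* compare the [h]-components of [z + 0] and [r x + x] *)
  have [_ x0] : r x = exist _ z gz /\ x = 0.
    by apply: (complement_decomp_uniq hc); rewrite raddf0 addr0.
  by rewrite -xE x0 !raddf0 addr0.
move=> ->; split; first exact: lsub0.
by exists 0 => //; rewrite !raddf0 addr0.
Qed.

(** The isomorphism is [x |-> r x + x], with the projection onto [h] along [g] as
    its inverse. *)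
Lemma graph_iso (h' : lieSubalg Xi) (r : {linear h -> g}) :
  lsub_set h' = graph r -> bracket_iso (deformed_bracket M r) (@lieb k h').
Proof.
move=> e.
have cl : deformation_maps M r.
  by apply/graph_lieb_closed; rewrite -e; apply: lsub_lieb.
have p x : lsub_pred h' (val (r x) + val x).
  by apply/asboolP; rewrite e; exists x.
have [f fE] : exists f : {linear h -> h'},
    f =1 fun x => exist _ (val (r x) + val x) (p x).
  apply: linear_pack => c x y; apply: val_inj; rewrite [RHS]linearP /= !linearP /=.
  by rewrite scalerDr addrACA.
exists f; split; last first.
  move=> x y; rewrite !fE; apply: val_inj; rewrite /= lieb_graph.
  by move/deformation_mapsE: cl => <-.
exists (fun z => (complement_proj hc (val z)).2).
  move=> x; rewrite fE /=; have := complement_projE hc (val (r x) + val x).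
  by move=> /(complement_decomp_uniq hc)[].
move=> z; rewrite fE; apply: val_inj => /=.
have : graph r (val z) by rewrite -e; apply: lsub_valP.
move=> [x _ <-]; have := complement_projE hc (val (r x) + val x).
by move=> /(complement_decomp_uniq hc)[_ <-].
Qed.

Lemma deformation_graph (r : {linear h -> g}) : deformation_maps M r ->
  exists2 h' : lieSubalg Xi, is_complement g h' & lsub_set h' = graph r.
Proof.
move/graph_lieb_closed => cl.
have g0 : graph r 0 by exists 0 => //; rewrite !raddf0 addr0.
have gZD c u v : graph r u -> graph r v -> graph r (c *: u + v).
  move=> [x _ <-] [y _ <-]; exists (c *: x + y) => //.
  by rewrite !linearP /= scalerDr addrACA.
exists (LieSubalg g0 gZD cl) => //; exact: graph_complement.
Qed.

(** If [x = a + y] along [Xi = g + h'], then [- a + x = y] belongs to [h'], so [r]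
    is the opposite of the projection of [h] to [g] along [h']. *)
Lemma complement_graph (h' : lieSubalg Xi) : is_complement g h' ->
  exists2 r, deformation_maps M r & lsub_set h' = graph r.
Proof.
move=> hc'.
have [r rE] : exists r : {linear h -> g},
    r =1 fun x => - (complement_proj hc' (val x)).1.
  apply: linear_pack => c x y; rewrite scalerN -opprD; congr (- _).
  have e z := esym (complement_projE hc' z).
  have [] := @complement_decomp_uniq _ _ _ _ hc'
    (complement_proj hc' (val (c *: x + y))).1
    (c *: (complement_proj hc' (val x)).1 + (complement_proj hc' (val y)).1)
    (complement_proj hc' (val (c *: x + y))).2
    (c *: (complement_proj hc' (val x)).2 + (complement_proj hc' (val y)).2) => //.
  by rewrite e !linearP /= addrACA -scalerDr !e.
have rx x : val (r x) + val x = val (complement_proj hc' (val x)).2.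
  rewrite rE raddfN /= {2}[sval x](complement_projE hc') addKr //.
have e : lsub_set h' = graph r.
  apply/seteqP; split=> z; last by move=> [x _ <-]; rewrite rx; apply: lsub_valP.
  move=> /asboolP hz; have [[a x] /= zE] := complement_decomp hc z.
  exists x => //; rewrite rx.
  (* [x] decomposes both as [- a + z] and through the projections along [h'] *)
  have [] := @complement_decomp_uniq _ _ _ _ hc'
    (- a) (complement_proj hc' (val x)).1
    (exist _ z hz) (complement_proj hc' (val x)).2; last by move=> _ <-.
  by rewrite -complement_projE raddfN /= zE addKr.
exists r => //; apply/graph_lieb_closed; rewrite -e; exact: lsub_lieb.
Qed.

Lemma graph_iso_equiv (h1 h2 : lieSubalg Xi) (r1 r2 : {linear h -> g}) :
  lsub_set h1 = graph r1 -> lsub_set h2 = graph r2 ->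
  lie_isomorphic h1 h2 <-> deformation_equiv M r1 r2.
Proof.
move=> /graph_iso i1 /graph_iso i2.
split=> [i|/deformation_equivE i].
  apply/deformation_equivE/(bracket_iso_trans i1)/(bracket_iso_trans i).
  exact: bracket_iso_sym.
apply: bracket_iso_trans (bracket_iso_sym i1) _; exact: bracket_iso_trans i i2.
Qed.

End Graph.

Local Open Scope card_scope.

Theorem theorem4p5 (k : comPzRingType) (Xi : lieAlgType k)
    (g h : lieSubalg Xi) (hc : is_complement g h) :
  let M := canonical_matched_pair hc in
  [/\ equivalence_on (deformation_maps M) (deformation_equiv M),
      exists F : set (lieSubalg Xi) -> set {linear h -> g},
        set_bij (complement_classes g) (HA2 M) F &
      complement_classes g #= HA2 M].
Proof.
move=> M.
have [F bF] : exists F, set_bij (complement_classes g) (HA2 M) F.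
  apply: (@quotient_correspondence _ _ _ _ _ _
    (fun h' (r : {linear h -> g}) => lsub_set h' = graph r)).
  - exact: complement_graph.
  - exact: deformation_graph.
  - move=> h1 h2 r1 r2; exact: graph_iso_equiv.
split; first exact: deformation_equiv_equivalence.
- by exists F.
- by apply/card_set_bijP; exists F.
Qed.
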